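(* Let $\{q_{\mathbf X}(\cdot;\delta)\}_{|\delta|<\delta^*}$, $\delta^*>0$, be a family of Lebesgue densities on $\mathbb R^{d_1+d_2}$ for $\mathbf X=(\mathbf X_1,\mathbf X_2)$, with marginal densities $q_{\mathbf X_1}(\cdot;\delta)$ on $\mathbb R^{d_1}$ and $q_{\mathbf X_2}(\cdot;\delta)$ on $\mathbb R^{d_2}$, satisfying: (i) $q_{\mathbf X}(\mathbf x;\delta)=q_{\mathbf X_1}(\mathbf x_1;\delta)q_{\mathbf X_2}(\mathbf x_2;\delta)$ holds if and only if $\delta=0$; (ii) the family is quadratic mean differentiable at $\delta=0$ with score function $\dot\ell(\cdot;0)$, i.e. $\int\big(\sqrt{q_{\mathbf X}(\mathbf x;\delta)}-\sqrt{q_{\mathbf X}(\mathbf x;0)}-\tfrac12\delta\,\dot\ell(\mathbf x;0)\sqrt{q_{\mathbf X}(\mathbf x;0)}\big)^2d\mathbf x=o(\delta^2)$ as $\delta\to0$; (iii) $\mathcal I_{\mathbf X}(0)=\int\{\dot\ell(\mathbf x;0)\}^2q_{\mathbf X}(\mathbf x;0)\,d\mathbf x>0$; (iv) $\dot\ell(\mathbf x;0)$ is not additively separable, i.e. there do not exist functions $h_1,h_2$ with $\dot\ell(\mathbf x;0)=h_1(\mathbf x_1)+h_2(\mathbf x_2)$. Let $\alpha\in(0,1)$. Then for any $\beta>0$ such that $\alpha+\beta<1$ there exists an absolute constant $c_\beta>0$ such that, as long as $|\delta_0|\le c_\beta$, $$\inf_{\overline{\mathsf T}^{(n)}_\alpha\in\mathcal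 T^{(n)}_\alpha}P\big\{\overline{\mathsf T}^{(n)}_\alpha=0\,\big|\,H_1^{(n)}(\delta_0)\big\}\ge1-\alpha-\beta$$ for all sufficiently large $n$, where the infimum is over the class $\mathcal T^{(n)}_\alpha$ of all size-$\alpha$ tests.
   Context: $H_1^{(n)}(\delta_0)$, $\delta_0\neq 0$, is the local alternative under which the observations $(\mathbf X_{1i},\mathbf X_{2i})$, $i=1,\dots,n$, are i.i.d. with density $q_{\mathbf X}(\cdot;\delta^{(n)})$, $\delta^{(n)}=n^{-1/2}\delta_0$. In this local model, testing the null hypothesis of independence of $\mathbf X_1,\mathbf X_2$ reduces to testing $H_0:\delta_0=0$ versus $H_1:\delta_0\ne0$. A test is a measurable $\{0,1\}$-valued function of the sample of size $n$ (value $1$ meaning rejection); a size-$\alpha$ test is one whose rejection probability under $H_0$ (i.e. under i.i.d. sampling from $q_{\mathbf X}(\cdot;0)$) is at most $\alpha$. *)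

(* Defs.v *)
From HB Require Import structures.
From mathcomp Require Import all_boot all_order all_algebra.
From mathcomp Require Import all_classical all_reals all_analysis.
From mathcomp Require Import measurable_realfun.

Set Implicit Arguments.
Unset Strict Implicit.
Unset Printing Implicit Defensive.

Import Order.TTheory GRing.Theory Num.Theory.
Import numFieldNormedType.Exports.

Local Open Scope classical_set_scope.
Local Open Scope ring_scope.

Definition tuple_cons (T : Type) n (x : T * n.-tuple T) : n.+1.-tuple T :=
  [tuple of x.1 :: x.2].

Lemma measurable_tuple_cons d (T : measurableType d) n :
  measurable_fun setT (@tuple_cons T n).
Proof. exact: measurable_cons. Qed.

(* The n-fold product mu \x ... \x mu on n.-tuple T. It is used both for
   Lebesgue measure on R^n and for the law of an i.i.d. sample of size n. *)
Fixpoint tuple_measure d (T : measurableType d) (R : realType)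
    (mu : set T -> \bar R) n : set (n.-tuple T) -> \bar R :=
  if n is n'.+1 return set (n.-tuple T) -> \bar R
  then pushforward (mu \x tuple_measure mu (n := n'))%E (@tuple_cons T n')
  else \d_([tuple] : 0.-tuple T).
Arguments tuple_measure {d T R} mu n _.

Lemma product_measure_sigma_finite d1 d2 (T1 : measurableType d1)
    (T2 : measurableType d2) (R : realType)
    (m1 : {sigma_finite_measure set T1 -> \bar R})
    (m2 : {sigma_finite_measure set T2 -> \bar R}) :
  sigma_finite setT (m1 \x m2)%E.
Proof.
have /sigma_finiteP[F [TF ndF Foo]] := sigma_finiteT m1.
have /sigma_finiteP[G [TG ndG Goo]] := sigma_finiteT m2.
exists (fun n => F n `*` G n).
  rewrite -setXTT TF TG predeqE => -[x y]; split.
    move=> [/= [n _ Fnx] [k _ Gky]]; exists (maxn n k) => //; split.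
    - by move: x Fnx; exact/subsetPset/ndF/leq_maxl.
    - by move: y Gky; exact/subsetPset/ndG/leq_maxr.
  by move=> [n _ []/= ? ?]; split; exists n.
move=> k; have [? ?] := Foo k; have [? ?] := Goo k.
split; first exact: measurableX.
by rewrite product_measure1E// lte_mul_pinfty// ge0_fin_numE.
Qed.

Section product_cons.
Context d (T : measurableType d) (R : realType) (n : nat).
Variable m1 : {sigma_finite_measure set T -> \bar R}.
Variable m2 : {sigma_finite_measure set (n.-tuple T) -> \bar R}.

Definition product_cons := pushforward (m1 \x m2)%E (@tuple_cons T n).

Let measurable_preimage A : measurable A -> measurable (@tuple_cons T n @^-1` A).
Proof.
by move=> mA; rewrite -[X in measurable X]setTI; exact: measurable_tuple_cons.
Qed.

Let product_cons0 : product_cons set0 = 0%E.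
Proof. by rewrite /product_cons /pushforward preimage_set0 measure0. Qed.

Let product_cons_ge0 A : (0 <= product_cons A)%E.
Proof. by rewrite /product_cons /pushforward measure_ge0. Qed.

Let product_cons_sigma_additive : semi_sigma_additive product_cons.
Proof.
move=> F mF tF mUF; rewrite /product_cons /pushforward preimage_bigcup.
apply: measure_semi_sigma_additive.
- by move=> i; exact: measurable_preimage.
- apply/trivIsetP => /= i j _ _ ij; rewrite -preimage_setI.
  by move/trivIsetP : tF => /(_ _ _ _ _ ij) ->//; rewrite preimage_set0.
- by rewrite -preimage_bigcup; exact: measurable_preimage.
Qed.

HB.instance Definition _ := isMeasure.Build _ _ _ product_cons
  product_cons0 product_cons_ge0 product_cons_sigma_additive.

Let product_cons_sigma_finite : sigma_finite setT product_cons.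
Proof.
have [F FT Foo] := product_measure_sigma_finite m1 m2.
pose g (s : n.+1.-tuple T) : (T * n.-tuple T)%type :=
  (thead s, [tuple of behead s]).
have mg : measurable_fun setT g.
  apply/measurable_fun_pairP; split; first exact: measurable_tnth.
  exact: measurable_behead.
exists (fun i => g @^-1` F i).
  by rewrite -preimage_bigcup -FT preimage_setT.
move=> i; have [mFi Fioo] := Foo i; split.
  by rewrite -[X in measurable X]setTI; exact: mg.
rewrite /product_cons /pushforward -comp_preimage.
suff -> : g \o @tuple_cons T n = id by rewrite preimage_id.
apply/funext => -[x s] /=; rewrite /g /tuple_cons /=; congr pair.
exact/val_inj.
Qed.

HB.instance Definition _ := Measure_isSigmaFinite.Build _ _ _ product_cons
  product_cons_sigma_finite.

Lemma product_cons_sigma_finite_measure :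
  exists nu : {sigma_finite_measure set (n.+1.-tuple T) -> \bar R},
    pushforward (m1 \x m2)%E (@tuple_cons T n) = nu :> (set _ -> _).
Proof. by exists product_cons. Qed.

End product_cons.

Section tuple_measure_theory.
Context d (T : measurableType d) (R : realType).
Variable mu : {sigma_finite_measure set T -> \bar R}.

Let tuple_measure_sigma_finite n :
  exists nu : {sigma_finite_measure set (n.-tuple T) -> \bar R},
    tuple_measure mu n = nu :> (set (n.-tuple T) -> \bar R).
Proof.
elim: n => [|n [nu nuE]].
  by exists (\d_([tuple] : 0.-tuple T) : probability (0.-tuple T) R).
have [nu' nuE'] := product_cons_sigma_finite_measure mu nu.
by exists nu' => /=; rewrite nuE.
Qed.

Let tuple_measure0 n : tuple_measure mu n set0 = 0%E.
Proof. by have [nu ->] := tuple_measure_sigma_finite n; exact: measure0. Qed.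

Let tuple_measure_ge0 n A : (0 <= tuple_measure mu n A)%E.
Proof. by have [nu ->] := tuple_measure_sigma_finite n; rewrite measure_ge0. Qed.

Let tuple_measure_sigma_additive n : semi_sigma_additive (tuple_measure mu n).
Proof.
have [nu ->] := tuple_measure_sigma_finite n.
exact: measure_semi_sigma_additive.
Qed.

HB.instance Definition _ n := isMeasure.Build _ _ _ (tuple_measure mu n)
  (tuple_measure0 n) (@tuple_measure_ge0 n) (@tuple_measure_sigma_additive n).

Let tuple_measure_sigma_finiteT n : sigma_finite setT (tuple_measure mu n).
Proof.
by have [nu ->] := tuple_measure_sigma_finite n; exact: sigma_finiteT.
Qed.

HB.instance Definition _ n := Measure_isSigmaFinite.Build _ _ _
  (tuple_measure mu n) (tuple_measure_sigma_finiteT n).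

Lemma tuple_measure_box n (A : 'I_n -> set T) :
  (forall i, measurable (A i)) ->
  tuple_measure mu n [set s | forall i, A i (tnth s i)] =
    (\prod_(i < n) mu (A i))%E.
Proof.
elim: n A => [|n IH] A mA.
  by rewrite big_ord0 /= diracE mem_set// => -[].
have mB : measurable [set s : n.-tuple T |
    forall i, A (lift ord0 i) (tnth s i)].
  rewrite (_ : mkset _ = \bigcap_(i in [set: 'I_n])
      ((@tnth n T)^~ i @^-1` A (lift ord0 i))); last first.
    by apply/seteqP; split => s /= h i; [move=> _; exact: h|exact: (h i I)].
  apply: fin_bigcap_measurable => // i _.
  by rewrite -[X in measurable X]setTI; exact: measurable_tnth.
rewrite big_ord_recl -IH; last by move=> i; exact: mA.
rewrite -product_measure1E//= /pushforward; congr (_ _).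
apply/seteqP; split => -[x s] /=.
  move=> h; split=> [|i]; first by have := h ord0; rewrite tnth0.
  by have := h (lift ord0 i); rewrite tnthS.
move=> [Ax As] i; case: (unliftP ord0 i) => [j|] ->; last by rewrite tnth0.
by rewrite tnthS.
Qed.

End tuple_measure_theory.

Notation euclidean R d := (d.-tuple (measurableTypeR R)) (only parsing).

Definition lebesgue_euclidean (R : realType) (d : nat) :
    set (euclidean R d) -> \bar R :=
  tuple_measure (@lebesgue_measure R) d.

HB.instance Definition _ (R : realType) (d : nat) :=
  SigmaFiniteMeasure.copy (@lebesgue_euclidean R d)
    (tuple_measure (@lebesgue_measure R) d).

(* Lebesgue measure on R^(d1 + d2), seen as R^d1 * R^d2. *)
Definition lebesgue_blocks (R : realType) (d1 d2 : nat) :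
    set (euclidean R d1 * euclidean R d2) -> \bar R :=
  (@lebesgue_euclidean R d1 \x @lebesgue_euclidean R d2)%E.
Arguments lebesgue_blocks R d1 d2 _ : clear implicits.

HB.instance Definition _ (R : realType) (d1 d2 : nat) :=
  Measure.copy (@lebesgue_blocks R d1 d2)
    (@lebesgue_euclidean R d1 \x @lebesgue_euclidean R d2)%E.

HB.instance Definition _ (R : realType) (d1 d2 : nat) :=
  Measure_isSigmaFinite.Build _ _ _ (@lebesgue_blocks R d1 d2)
    (product_measure_sigma_finite (@lebesgue_euclidean R d1)
      (@lebesgue_euclidean R d2)).

Section densities.
Context d (T : measurableType d) (R : realType).
Local Open Scope ereal_scope.

Definition is_density (mu : set T -> \bar R) (f : T -> R) :=
  [/\ measurable_fun setT f, forall x, (0 <= f x)%R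
    & \int[mu]_x (f x)%:E = 1].

Definition law (mu : set T -> \bar R) (f : T -> R) : set T -> \bar R :=
  fun A => \int[mu]_(x in A) (f x)%:E.

Definition iid_law (mu : set T -> \bar R) (f : T -> R) n :
  set (n.-tuple T) -> \bar R := tuple_measure (law mu f) n.

(* The remainder is integrated in \bar R, so that the bound also asserts that
   the integral is finite. *)
Definition qmd_at0 (mu : set T -> \bar R) (q : R -> T -> R) (l : T -> R) :=
  forall e : R, (0 < e)%R -> \forall delta \near (0%R : R),
    \int[mu]_x ((Num.sqrt (q delta x) - Num.sqrt (q 0%R x)
      - 2^-1 * delta * l x * Num.sqrt (q 0%R x)) ^+ 2)%R%:E
    <= (e * delta ^+ 2)%R%:E.

Definition fisher_information (mu : set T -> \bar R) (f l : T -> R) : \bar R :=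
  \int[mu]_x (l x ^+ 2 * f x)%R%:E.

End densities.
Arguments iid_law {d T R} mu f n _.

Section law_probability.
Context d (T : measurableType d) (R : realType).
Variable mu : {measure set T -> \bar R}.
Local Open Scope ereal_scope.

Lemma law_probability (f : T -> R) : is_density mu f ->
  exists P : probability T R, law mu f = P :> (set T -> \bar R).
Proof.
move=> [mf f0 f1].
have law0 : law mu f set0 = 0 by rewrite /law integral_set0.
have law_ge0 A : 0 <= law mu f A.
  by apply: integral_ge0 => x _; rewrite lee_fin.
have law_sigma : semi_sigma_additive (law mu f).
  apply: semi_sigma_additive_nng_induced; first exact/measurable_EFinP.
  by move=> x; rewrite lee_fin.
pose m := isMeasure.Build _ _ _ (law mu f) law0 law_ge0 law_sigma.
pose M : {measure set T -> \bar R} := HB.pack (law mu f) m.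
have MT : M setT = 1 by [].
pose p := Measure_isProbability.Build _ _ _ M MT.
pose P : probability T R := HB.pack (M : set T -> \bar R) M p.
by exists P.
Qed.

End law_probability.

Section two_blocks.
Context (R : realType) (d1 d2 : nat).
Local Open Scope ereal_scope.
Implicit Type f : euclidean R d1 * euclidean R d2 -> R.

Definition marginal1 f (x1 : euclidean R d1) : \bar R :=
  \int[@lebesgue_euclidean R d2]_x2 (f (x1, x2))%:E.

Definition marginal2 f (x2 : euclidean R d2) : \bar R :=
  \int[@lebesgue_euclidean R d1]_x1 (f (x1, x2))%:E.

(* Densities are only determined up to null sets, hence the equality almost
   everywhere. *)
Definition factorizes f :=
  {ae lebesgue_blocks R d1 d2, forall x,
    (f x)%:E = marginal1 f x.1 * marginal2 f x.2}.

Definition additively_separable f :=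
  exists (h1 : euclidean R d1 -> R) (h2 : euclidean R d2 -> R),
    forall x, f x = (h1 x.1 + h2 x.2)%R.

End two_blocks.

(* A test rejects when its value is true. *)
Definition size_tests d (T : measurableType d) (R : realType)
    (P0 : set T -> \bar R) (alpha : R) : set {mfun T >-> bool} :=
  [set phi | (P0 [set s | phi s = true] <= alpha%:E)%E].

(* Main.v *)
(* A quadratic mean expansion at 0 bounds the squared Hellinger distance between
   [q e] and [q 0] by [K * e ^ 2], so the affinity of the two densities at
   [e = delta0 / sqrt n] is at least [1 - K * delta0 ^ 2 / (2 * n)].  The
   affinity [r] of two densities satisfies
     [r ^ n <= sqrt (P A * Q A) + sqrt (P (~` A) * Q (~` A))]
   for the n-fold products [P], [Q] and every event [A], which bounds
   [(P A - Q A) ^ 2] by [1 - r ^ 2n] and hence, through Bernoulli's inequality,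
   by [K * delta0 ^ 2], uniformly in [n].  Thus no test gains more than [beta]
   in power over its size once [K * delta0 ^ 2 <= beta ^ 2]. *)

Require Import Defs.
From HB Require Import structures.
From mathcomp Require Import all_boot all_order all_algebra.
From mathcomp Require Import all_classical all_reals all_analysis.
From mathcomp Require Import measurable_realfun ring lra.

Set Implicit Arguments.
Unset Strict Implicit.
Unset Printing Implicit Defensive.

Import Order.TTheory GRing.Theory Num.Theory.
Import numFieldNormedType.Exports.

Local Open Scope classical_set_scope.
Local Open Scope ring_scope.

(** * Integration against a law with a density *)

Section law_integral.
Context d (T : measurableType d) (R : realType).
Variable mu : {sigma_finite_measure set T -> \bar R}.
Local Open Scope ereal_scope.

(** The law is dominated by [mu], so it has a Radon-Nikodym derivative. That derivative and [f] have
    the same integral over every measurable set, hence agree almost everywhere, and change of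
    variables concludes. *)
Lemma integral_law (f g : T -> R) : is_density mu f ->
    measurable_fun setT g -> (forall x, 0 <= g x)%R ->
  \int[law mu f]_x (g x)%:E = \int[mu]_x (g x * f x)%:E.
Proof.
move=> df mg g0; have [mf f0 f1] := df.
have [P PE] := law_probability df.
have Pmu : P `<< mu.
  apply/null_content_dominatesP => A mA muA0; rewrite -PE /law.
  by apply: null_set_integral => //; exact/measurable_EFinP/measurable_funTS.
have mRN := Radon_Nikodym_SigmaFinite.f_integrable Pmu.
rewrite PE -(Radon_Nikodym_SigmaFinite.change_of_variables Pmu)//;
  last exact/measurable_EFinP.
apply: ae_eq_integral => //.
- apply: emeasurable_funM; first exact/measurable_EFinP.
  exact: measurable_int mRN.
- exact/measurable_EFinP/measurable_funM.
- under [X in ae_eq _ _ _ X]eq_fun do rewrite EFinM.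
  apply: ae_eqe_mul2l; apply: integral_ae_eq => //.
    exact/measurable_EFinP.
  move=> E _ mE; rewrite -Radon_Nikodym_SigmaFinite.f_integral//.
  by rewrite -[RHS]/(law mu f E) PE.
Qed.

End law_integral.

(** * Cauchy-Schwarz for square roots *)

Lemma measurable_sqrt (R : realType) : measurable_fun setT (@Num.sqrt R).
Proof. apply: continuous_measurable_fun; exact: sqrt_continuous. Qed.

(** The right-hand side is the infimum over [t] of the weighted arithmetic-geometric bounds. *)
Lemma le_sqrtM_amgm (R : realType) (x a b : R) : 0 <= a -> 0 <= b ->
    (forall t, 0 < t -> x <= t / 2 * a + t^-1 / 2 * b) ->
  x <= Num.sqrt a * Num.sqrt b.
Proof.
move=> a0 b0 h; have [x0|x0] := leP x 0.
  by rewrite (le_trans x0)// mulr_ge0.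
rewrite -sqrtrM// -[leLHS]gtr0_norm// -sqrtr_sqr ler_wsqrtr//.
have {}h t : 0 < t -> 2 * x <= t * a + t^-1 * b by move=> /h; lra.
move: a0; rewrite le_eqVlt => /predU1P[a0|a0].
  (* For [a = 0] a large [t] contradicts [0 < x]: this one would give [2 * (b + 1) <= b]. *)
  have := h ((b + 1) / x) (divr_gt0 (ltr_wpDl b0 ltr01) x0).
  rewrite -a0 mulr0 add0r invf_div mul0r -mulrAC ler_pdivlMr; last lra.
  nra.
(* This [t] turns the bound into [2 * x <= x + a * b / x], that is [x ^ 2 <= a * b]. *)
have := h (x / a) (divr_gt0 x0 a0).
rewrite invf_div mulfVK ?gt_eqF// -mulrAC -lerBlDl ler_pdivlMr//.
nra.
Qed.

Section integral_bounds.
Context d (T : measurableType d) (R : realType).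
Variable mu : {measure set T -> \bar R}.
Local Open Scope ereal_scope.

Lemma ge0_integral_le_lincomb (f g h : T -> R) (s t a b : R) :
    measurable_fun setT f -> measurable_fun setT g -> measurable_fun setT h ->
    (forall x, 0 <= f x)%R -> (forall x, 0 <= g x)%R ->
    (forall x, 0 <= h x)%R -> (0 <= s)%R -> (0 <= t)%R ->
    (forall x, h x <= s * f x + t * g x)%R ->
    \int[mu]_x (f x)%:E <= a%:E -> \int[mu]_x (g x)%:E <= b%:E ->
  \int[mu]_x (h x)%:E <= (s * a + t * b)%:E.
Proof.
move=> /measurable_EFinP mf /measurable_EFinP mg /measurable_EFinP mh.
move=> f0 g0 h0 s0 t0 hfg fa gb.
have ef0 x : [set: T] x -> 0 <= (f x)%:E by rewrite lee_fin.
have eg0 x : [set: T] x -> 0 <= (g x)%:E by rewrite lee_fin.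
have sf0 x : [set: T] x -> 0 <= s%:E * (f x)%:E by rewrite lee_fin mulr_ge0.
have tg0 x : [set: T] x -> 0 <= t%:E * (g x)%:E by rewrite lee_fin mulr_ge0.
have msf := measurable_funeM s%:E mf; have mtg := measurable_funeM t%:E mg.
apply: (@le_trans _ _ (\int[mu]_x (s%:E * (f x)%:E + t%:E * (g x)%:E))).
  apply: ge0_le_integral => //.
  - by move=> x _; rewrite lee_fin.
  - exact: emeasurable_funD.
  - by move=> x _; rewrite lee_fin.
rewrite ge0_integralD// !ge0_integralZl_EFin//.
by rewrite EFinD !EFinM leeD// lee_wpmul2l.
Qed.

(** Cauchy-Schwarz: the pointwise bound from [0 <= (t * u - v) ^ 2], with [u], [v] the two square
    roots, is integrated for each [t], and [le_sqrtM_amgm] optimizes over [t]. The case [t = 1]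
    gives finiteness. *)
Lemma integral_sqrtM_le (f g : T -> R) (a b : R) :
    measurable_fun setT f -> measurable_fun setT g ->
    (forall x, 0 <= f x)%R -> (forall x, 0 <= g x)%R ->
    \int[mu]_x (f x)%:E = a%:E -> \int[mu]_x (g x)%:E = b%:E ->
  \int[mu]_x (Num.sqrt (f x) * Num.sqrt (g x))%:E
    <= (Num.sqrt a * Num.sqrt b)%:E.
Proof.
move=> mf mg f0 g0 fa gb.
have a0 : (0 <= a)%R.
  by rewrite -lee_fin -fa; apply: integral_ge0 => x _; rewrite lee_fin.
have b0 : (0 <= b)%R.
  by rewrite -lee_fin -gb; apply: integral_ge0 => x _; rewrite lee_fin.
set I := (X in X <= _).
have I0 : 0 <= I by apply: integral_ge0 => x _; rewrite lee_fin mulr_ge0.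
have h (t : R) : (0 < t)%R -> I <= (t / 2 * a + t^-1 / 2 * b)%:E.
  move=> t0; apply: (@ge0_integral_le_lincomb f g); rewrite ?fa ?gb//.
  - by apply: measurable_funM; exact: (measurableT_comp (@measurable_sqrt R)).
  - by rewrite divr_ge0// ltW.
  - by rewrite divr_ge0// invr_ge0 ltW.
  move=> x; rewrite -{2}(sqr_sqrtr (f0 x)) -{2}(sqr_sqrtr (g0 x)).
  set u := Num.sqrt _; set v := Num.sqrt _.
  have : (0 <= t^-1 / 2 * (t * u - v) ^+ 2)%R.
    by rewrite mulr_ge0 ?divr_ge0 ?invr_ge0 ?sqr_ge0// ltW.
  have -> : (t^-1 / 2 * (t * u - v) ^+ 2 =
      t / 2 * u ^+ 2 + t^-1 / 2 * v ^+ 2 - u * v)%R by field; rewrite gt_eqF.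
  by rewrite subr_ge0.
have Ifin : I \is a fin_num.
  by rewrite ge0_fin_numE// (le_lt_trans (h 1%R ltr01))// ltry.
rewrite -(fineK Ifin) lee_fin; apply: le_sqrtM_amgm => // t t0.
by rewrite -lee_fin (fineK Ifin); exact: h.
Qed.

End integral_bounds.

(** * Affinity of product laws *)

Section iid_affinity.
Context d (T : measurableType d) (R : realType).
Variable mu : {sigma_finite_measure set T -> \bar R}.
Local Open Scope ereal_scope.

Lemma iid_law_probability (f : T -> R) n : is_density mu f ->
  exists P : probability (n.-tuple T) R,
    iid_law mu f n = P :> (set (n.-tuple T) -> \bar R).
Proof.
move=> df; have [P PE] := law_probability df.
have PnT : tuple_measure P n setT = 1.
  have := tuple_measure_box P (fun (_ : 'I_n) => measurableT).
  rewrite big1 => [<-|i _]; last exact: probability_setT.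
  by congr (tuple_measure P n _); apply/seteqP; split.
pose M : {measure set (n.-tuple T) -> \bar R} := tuple_measure P n.
pose p := Measure_isProbability.Build _ _ _ M PnT.
pose Pn : probability (n.-tuple T) R :=
  HB.pack (M : set (n.-tuple T) -> \bar R) M p.
by exists Pn; rewrite /iid_law PE.
Qed.

Let slice n (A : set (n.+1.-tuple T)) x := xsection (@tuple_cons T n @^-1` A) x.

Let sliceC n (A : set (n.+1.-tuple T)) x : slice (~` A) x = ~` slice A x.
Proof. by rewrite /slice !xsectionE. Qed.

Let measurable_cons_preimage n (A : set (n.+1.-tuple T)) :
  measurable A -> measurable (@tuple_cons T n @^-1` A).
Proof.
by move=> mA; rewrite -[X in measurable X]setTI; exact: measurable_tuple_cons.
Qed.

Let measurable_slice n (A : set (n.+1.-tuple T)) x :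
  measurable A -> measurable (slice A x).
Proof.
by move=> mA; apply: measurable_xsection; exact: measurable_cons_preimage.
Qed.

Let measurable_law_slice (f : T -> R) n (A : set (n.+1.-tuple T)) :
    is_density mu f -> measurable A ->
  measurable_fun setT (fun x => fine (iid_law mu f n (slice A x))).
Proof.
move=> df mA; have [P PE] := iid_law_probability n df.
apply/measurable_EFinP; rewrite PE.
rewrite (_ : _ \o _ = P \o xsection (@tuple_cons T n @^-1` A)).
  by apply: measurable_fun_xsection; exact: measurable_cons_preimage.
apply/funext => x /=; rewrite fineK//; apply: fin_num_measure.
exact: measurable_slice.
Qed.

Let iid_law_slice (f : T -> R) n (A : set (n.+1.-tuple T)) :
    is_density mu f -> measurable A ->
  iid_law mu f n.+1 A =
    \int[mu]_x (fine (iid_law mu f n (slice A x)) * f x)%:E.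
Proof.
move=> df mA; have [P PE] := iid_law_probability n df.
rewrite -integral_law//; last 2 first.
- exact: measurable_law_slice.
- by move=> x; rewrite PE; exact/fine_ge0/measure_ge0.
rewrite {1}/iid_law /= /pushforward /product_measure1.
congr integral; apply/funext => x /=; rewrite -/(iid_law mu f n) PE fineK//.
by apply: fin_num_measure; exact: measurable_slice.
Qed.

(* By induction on [n]: slice [A] along the first observation, and apply
   Cauchy-Schwarz to the slices of [A] and to those of its complement. *)
Lemma affinity_exprn_le (p q : T -> R) (r : R) n (A : set (n.-tuple T)) :
    is_density mu p -> is_density mu q ->
    \int[mu]_x (Num.sqrt (p x) * Num.sqrt (q x))%:E = r%:E -> measurable A ->
  let P B := fine (iid_law mu p n B) in let Q B := fine (iid_law mu q n B) in
  (r ^+ n <= Num.sqrt (P A) * Num.sqrt (Q A)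
             + Num.sqrt (P (~` A)) * Num.sqrt (Q (~` A)))%R.
Proof.
move=> dp dq pqr; have [mp p0 _] := dp; have [mq q0 _] := dq.
elim: n A => [A mA|n IH A mA] /=.
  (* On the one-point space exactly one of [A] and its complement has mass 1, under both laws, so
     the right-hand side is 1. *)
  rewrite expr0 /iid_law /=.
  rewrite /dirac !indicE in_setC; case: (_ \in A) => /=.
    by rewrite sqrtr0 sqrtr1 mulr1 mulr0 addr0.
  by rewrite sqrtr0 sqrtr1 mulr1 mulr0 add0r.
pose a (f : T -> R) B x := fine (iid_law mu f n (slice B x)).
have a0 f B x : is_density mu f -> (0 <= a f B x)%R.
  move=> /(iid_law_probability n)[P PE].
  by rewrite /a PE; exact/fine_ge0/measure_ge0.
have ma f B : is_density mu f -> measurable B -> measurable_fun setT (a f B).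
  exact: measurable_law_slice.
have CS B : measurable B ->
    \int[mu]_x (Num.sqrt (a p B x * p x) * Num.sqrt (a q B x * q x))%:E
    <= (Num.sqrt (fine (iid_law mu p n.+1 B)) *
        Num.sqrt (fine (iid_law mu q n.+1 B)))%:E.
  move=> mB.
  have [P PE] := iid_law_probability n.+1 dp.
  have [Q QE] := iid_law_probability n.+1 dq.
  apply: integral_sqrtM_le.
  - by apply: measurable_funM => //; exact: ma.
  - by apply: measurable_funM => //; exact: ma.
  - by move=> x; rewrite mulr_ge0// a0.
  - by move=> x; rewrite mulr_ge0// a0.
  - by rewrite -iid_law_slice// PE fineK// fin_num_measure.
  - by rewrite -iid_law_slice// QE fineK// fin_num_measure.
pose g B x := (Num.sqrt (a p B x * p x) * Num.sqrt (a q B x * q x))%R.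
have mg B : measurable B -> measurable_fun setT (EFin \o g B).
  move=> mB; apply/measurable_EFinP/measurable_funM;
    apply: (measurableT_comp (@measurable_sqrt R));
    by apply: measurable_funM => //; exact: ma.
have g0 B x : [set: T] x -> 0 <= (g B x)%:E.
  by rewrite lee_fin mulr_ge0.
have r0 : (0 <= r)%R.
  rewrite -lee_fin -pqr; apply: integral_ge0 => x _.
  by rewrite lee_fin mulr_ge0.
have mpq : measurable_fun setT (fun x => (Num.sqrt (p x) * Num.sqrt (q x))%:E).
  apply/measurable_EFinP/measurable_funM;
    exact: (measurableT_comp (@measurable_sqrt R)).
have mAC : measurable (~` A) by exact: measurableC.
rewrite -lee_fin EFinD.
apply: le_trans (leeD (CS _ mA) (CS _ mAC)).
rewrite -(ge0_integralD mu measurableT (g0 A) (mg _ mA) (g0 (~` A)) (mg _ mAC)).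
(* One factor [r] is written back as the affinity integral, which reduces the claim to an inequality
   of integrands. *)
rewrite exprSr EFinM -pqr -ge0_integralZl_EFin ?exprn_ge0//.
apply: ge0_le_integral => //.
- by move=> x _; rewrite lee_fin !mulr_ge0 ?exprn_ge0.
- exact: measurable_funeM.
- by apply: emeasurable_funD; exact: mg.
move=> x _; rewrite -EFinD -EFinM lee_fin.
(* Both terms share the factor [sqrt (p x) * sqrt (q x)]; what remains is the induction hypothesis
   for the slice at [x]. *)
have pull u v w z : (0 <= u)%R -> (0 <= v)%R ->
    (Num.sqrt (u * w) * Num.sqrt (v * z) =
     (Num.sqrt u * Num.sqrt v) * (Num.sqrt w * Num.sqrt z) :> R)%R.
  by move=> u0 v0; rewrite !sqrtrM// mulrACA.
rewrite /g !pull ?a0// -mulrDl ler_wpM2r ?mulr_ge0//.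
by have := IH (slice A x) (measurable_slice x mA); rewrite /= /a sliceC.
Qed.

End iid_affinity.

(** * Hellinger distance and quadratic mean differentiability *)

Section hellinger.
Context d (T : measurableType d) (R : realType).
Variable mu : {measure set T -> \bar R}.
Local Open Scope ereal_scope.

(** Normalized without the factor 1/2: for two densities the value is 2 minus twice the affinity. *)
Definition hellinger_sqr (p q : T -> R) : \bar R :=
  \int[mu]_x ((Num.sqrt (p x) - Num.sqrt (q x)) ^+ 2)%:E.

(** Integrate [p + q = (sqrt p - sqrt q) ^ 2 + 2 * sqrt p * sqrt q], whose left side has integral 2;
    Cauchy-Schwarz makes the affinity finite. *)
Lemma affinity_hellinger (p q : T -> R) (h : R) :
    is_density mu p -> is_density mu q -> hellinger_sqr p q <= h%:E ->
  exists2 r : R, \int[mu]_x (Num.sqrt (p x) * Num.sqrt (q x))%:E = r%:E &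
    (1 - h / 2 <= r)%R.
Proof.
move=> [mp p0 p1] [mq q0 q1] Hh.
have msp := measurableT_comp (@measurable_sqrt R) mp.
have msq := measurableT_comp (@measurable_sqrt R) mq.
set I := \int[mu]_x _.
have Ifin : I \is a fin_num.
  rewrite ge0_fin_numE; last first.
    by apply: integral_ge0 => x _; rewrite lee_fin mulr_ge0.
  exact: le_lt_trans (integral_sqrtM_le mp mq p0 q0 p1 q1) (ltry _).
exists (fine I); first by rewrite fineK.
suff : 2%:E <= (1 * h + 2 * fine I)%:E by rewrite lee_fin; lra.
have <- : \int[mu]_x (p x + q x)%:E = 2%:E.
  under eq_integral do rewrite EFinD.
  rewrite ge0_integralD//; first by rewrite p1 q1.
  - by move=> x _; rewrite lee_fin.
  - exact/measurable_EFinP.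
  - by move=> x _; rewrite lee_fin.
  - exact/measurable_EFinP.
pose g x := (Num.sqrt (p x) * Num.sqrt (q x))%R.
apply: (ge0_integral_le_lincomb (g := g) _ _ _ _ _ _ _ _ _ Hh) => //.
- by apply: measurable_funX; exact: measurable_funB.
- exact: measurable_funM msp msq.
- exact: measurable_funD.
- by move=> x; rewrite sqr_ge0.
- by move=> x; rewrite mulr_ge0.
- by move=> x; rewrite addr_ge0.
- move=> x; rewrite /g -{1}(sqr_sqrtr (p0 x)) -{1}(sqr_sqrtr (q0 x)).
  by rewrite le_eqVlt; apply/orP; left; apply/eqP; ring.
- by rewrite fineK.
Qed.

(* The remainder at one small parameter value shows that the information is
   finite; the remainder at [e] then compares the Hellinger distance with it. *)
Lemma qmd_hellinger_sqr_le (q : R -> T -> R) (l : T -> R) :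
    (\forall e \near (0%R : R), is_density mu (q e)) -> measurable_fun setT l ->
    qmd_at0 mu q l ->
  exists2 K : R, (0 < K)%R & \forall e \near (0%R : R),
    hellinger_sqr (q e) (q 0%R) <= (K * e ^+ 2)%:E.
Proof.
move=> dq ml /(_ 1%R ltr01) qmd.
have [eps /= eps0 H] := (@nbhs_ballP R R 0%R _).1 (filterI dq qmd).
pose s e x := Num.sqrt (q e x).
pose w e x := (2^-1 * e * l x * s 0%R x)%R.
pose rem e x := (s e x - s 0%R x - w e x)%R.
have dens e : (`|e| < eps)%R -> is_density mu (q e).
  by move=> ee; have [] := H e; first by rewrite /ball /= sub0r normrN.
have remle e : (`|e| < eps)%R -> \int[mu]_x (rem e x ^+ 2)%:E <= (e ^+ 2)%:E.
  move=> ee; have [|_ /=] := H e; first by rewrite /ball /= sub0r normrN.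
  by rewrite mul1r.
have small0 : (`|0 : R| < eps)%R by rewrite normr0.
have ms e : (`|e| < eps)%R -> measurable_fun setT (s e).
  by move=> /dens[mq _ _]; exact: (measurableT_comp (@measurable_sqrt R)).
have mw e : measurable_fun setT (w e).
  apply: measurable_funM; last exact: ms.
  by apply: measurable_funM => //; exact: measurable_cst.
have mrem e : (`|e| < eps)%R -> measurable_fun setT (rem e).
  by move=> ee; apply: measurable_funB => //; apply: measurable_funB; exact: ms.
pose e1 := (eps / 2)%R.
have e10 : (0 < e1)%R by rewrite divr_gt0.
have small1 : (`|e1| < eps)%R by rewrite gtr0_norm// /e1; lra.
have [m0 p0 i0] := dens _ small0; have [m1 p1 i1] := dens _ small1.
have sumle : \int[mu]_x (q e1 x + q 0%R x)%:E <= (1 * 1 + 1 * 1)%:E.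
  apply: (ge0_integral_le_lincomb (f := q e1) (g := q 0%R));
    rewrite ?i1 ?i0//.
  - exact: measurable_funD.
  - by move=> x; rewrite addr_ge0.
  - by move=> x; rewrite !mul1r.
(* The linear term is [s e1 - s 0 - rem e1], and the square of a sum of three terms is at most three
   times the sum of their squares. *)
have wle : \int[mu]_x (w e1 x ^+ 2)%:E <=
    (3 * (1 * 1 + 1 * 1) + 3 * e1 ^+ 2)%:E.
  have remle1 := remle _ small1.
  apply: (ge0_integral_le_lincomb _ _ _ _ _ _ _ _ _ sumle remle1) => //.
  - exact: measurable_funD.
  - by apply: measurable_funX; exact: mrem.
  - exact: measurable_funX.
  - by move=> x; rewrite addr_ge0.
  - by move=> x; rewrite sqr_ge0.
  - by move=> x; rewrite sqr_ge0.
  move=> x; rewrite /rem /s -{1}(sqr_sqrtr (p0 x)) -{1}(sqr_sqrtr (p1 x)).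
  rewrite -!/(s _ _); move: (s e1 x) (s 0%R x) (w e1 x) => u v z.
  have := sqr_ge0 (u + v); have := sqr_ge0 (u + (u - v - z)).
  by have := sqr_ge0 (v - (u - v - z)); lra.
set C := (X in _ <= X%:E) in wle.
(* From [s e - s 0 = rem e + w e], the squared difference is at most [2 * rem e ^ 2 + 2 * w e ^ 2].
   Linearity in the parameter, [w e = (e / e1) * w e1], then brings in [C]. *)
exists (2 + 2 * e1^-1 ^+ 2 * C)%R.
  have C0 : (0 <= C)%R by rewrite /C; have := sqr_ge0 e1; lra.
  by rewrite ltr_wpDr// mulr_ge0// mulr_ge0// sqr_ge0.
apply/nbhs_ballP; exists eps => //= e; rewrite /ball /= sub0r normrN => ee.
rewrite (_ : _ * _ = 2 * e ^+ 2 + 2 * (e / e1) ^+ 2 * C)%R; last by ring.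
apply: (ge0_integral_le_lincomb _ _ _ _ _ _ _ _ _ (remle _ ee) wle) => //.
- by apply: measurable_funX; exact: mrem.
- exact: measurable_funX.
- by apply: measurable_funX; apply: measurable_funB; exact: ms.
- by move=> x; rewrite sqr_ge0.
- by move=> x; rewrite sqr_ge0.
- by move=> x; rewrite sqr_ge0.
- by rewrite mulr_ge0// sqr_ge0.
move=> x; rewrite -mulrA -exprMn.
have -> : (e / e1 * w e1 x = w e x)%R by rewrite /w; field; rewrite gt_eqF.
rewrite /rem -!/(s _ _); move: (s e x) (s 0%R x) (w e x) => u v z.
by have := sqr_ge0 (u - v - z - z); lra.
Qed.

End hellinger.

(** * Real inequalities: Bernoulli, and affinity against difference of probabilities *)

Lemma ler_bernoulli (R : realDomainType) (x : R) n :
  0 <= x -> x <= 1 -> 1 - n%:R * x <= (1 - x) ^+ n.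
Proof.
move=> x0 x1; elim: n => [|n IH]; first by rewrite mul0r subr0.
have x10 : 0 <= 1 - x by rewrite subr_ge0.
rewrite exprS; apply: le_trans (ler_wpM2l x10 IH).
rewrite -natr1 -subr_ge0.
rewrite (_ : _ - _ = n%:R * x ^+ 2); last by ring.
by rewrite mulr_ge0 ?sqr_ge0.
Qed.

(* With [a = cos^2 u] and [b = cos^2 v] this is
   [b - a = sin (u - v) * sin (u + v) <= |sin (u - v)|]. *)
Lemma sub_sqr_le_affinity (R : rcfType) (a b s : R) :
    0 <= a -> a <= 1 -> 0 <= b -> b <= 1 -> 0 <= s ->
    s <= Num.sqrt a * Num.sqrt b + Num.sqrt (1 - a) * Num.sqrt (1 - b) ->
  (b - a) ^+ 2 <= 1 - s ^+ 2.
Proof.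
move=> a0 a1 b0 b1 s0.
have := sqr_sqrtr a0; have := sqr_sqrtr b0.
have := sqr_sqrtr (_ : 0 <= 1 - a); rewrite subr_ge0 => /(_ a1).
have := sqr_sqrtr (_ : 0 <= 1 - b); rewrite subr_ge0 => /(_ b1).
move: (Num.sqrt a) (Num.sqrt b) (Num.sqrt (1 - a)) (Num.sqrt (1 - b)).
(* Now [u], [v] are the cosine and sine of the angle of [a], and [w], [z] those of the angle of [b].
   Below, [e1] and [e2] say that squared sine and cosine sum to 1 for the difference and the sum of
   the angles. *)
move=> u w v z z2 v2 w2 u2 sle.
have {}sle : s ^+ 2 <= (u * w + v * z) ^+ 2.
  by rewrite ler_pXn2r// nnegrE// (le_trans s0).
have ab : (b - a) ^+ 2 = (u * z - v * w) ^+ 2 * (u * z + v * w) ^+ 2.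
  rewrite -exprMn.
  have -> : (u * z - v * w) * (u * z + v * w) =
      u ^+ 2 * z ^+ 2 - v ^+ 2 * w ^+ 2 by ring.
  by rewrite u2 z2 v2 w2; ring.
have e1 : (u * z - v * w) ^+ 2 + (u * w + v * z) ^+ 2 = 1.
  have -> : (u * z - v * w) ^+ 2 + (u * w + v * z) ^+ 2 =
      (u ^+ 2 + v ^+ 2) * (w ^+ 2 + z ^+ 2) by ring.
  by rewrite u2 v2 w2 z2; ring.
have e2 : (u * z + v * w) ^+ 2 + (u * w - v * z) ^+ 2 = 1.
  have -> : (u * z + v * w) ^+ 2 + (u * w - v * z) ^+ 2 =
      (u ^+ 2 + v ^+ 2) * (w ^+ 2 + z ^+ 2) by ring.
  by rewrite u2 v2 w2 z2; ring.
rewrite ab; apply: (@le_trans _ _ ((u * z - v * w) ^+ 2)); last lra.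
by rewrite ler_piMr ?sqr_ge0//; have := sqr_ge0 (u * w - v * z); lra.
Qed.

(** * Two-point testing bound *)

Section two_point.
Context d (T : measurableType d) (R : realType).
Variable mu : {sigma_finite_measure set T -> \bar R}.
Local Open Scope ereal_scope.

(** The affinity is at least [1 - b ^ 2 / (2 * n)], so its [n]-th power is at least [1 - b ^ 2 / 2].
    The squared difference of the probabilities is then at most [1 - (1 - b ^ 2 / 2) ^ 2 = b ^ 2 - b
    ^ 4 / 4]. *)
Lemma iid_law_le_hellinger (p q : T -> R) (b : R) n (A : set (n.-tuple T)) :
    is_density mu p -> is_density mu q -> (0 < n)%N ->
    (0 <= b)%R -> (b <= 1)%R ->
    hellinger_sqr mu p q <= (b ^+ 2 / n%:R)%:E -> measurable A ->
  iid_law mu q n A <= iid_law mu p n A + b%:E.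
Proof.
move=> dp dq n0 b0 b1 Hpq mA.
have [r rE rge] := affinity_hellinger dp dq Hpq.
have := affinity_exprn_le dp dq rE mA.
have [P ->] := iid_law_probability n dp.
have [Q ->] := iid_law_probability n dq.
rewrite /= !probability_setC// => rle.
have Pfin := fin_num_measure P A mA; have Qfin := fin_num_measure Q A mA.
have P0 : (0 <= fine (P A))%R by exact/fine_ge0/measure_ge0.
have Q0 : (0 <= fine (Q A))%R by exact/fine_ge0/measure_ge0.
have P1 : (fine (P A) <= 1)%R by rewrite -lee_fin fineK// probability_le1.
have Q1 : (fine (Q A) <= 1)%R by rewrite -lee_fin fineK// probability_le1.
have nR : (1 <= n%:R :> R)%R by rewrite ler1n.
have bb : (b ^+ 2 <= 1)%R by rewrite expr_le1.
set x := (b ^+ 2 / n%:R / 2)%R in rge.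
have x0 : (0 <= x)%R by rewrite !divr_ge0 ?sqr_ge0.
have nx : (n%:R * x = b ^+ 2 / 2)%R.
  by rewrite /x; field; rewrite gt_eqF// (lt_le_trans _ nR).
have x1 : (x <= 1)%R.
  by rewrite (@le_trans _ _ (n%:R * x)%R) ?ler_peMl// nx; lra.
have sle : (1 - b ^+ 2 / 2 <= r ^+ n)%R.
  rewrite -nx; apply: (le_trans (ler_bernoulli n x0 x1)).
  by rewrite lerXn2r// nnegrE ?subr_ge0// (le_trans _ rge)// subr_ge0.
rewrite -(fineK Pfin) -(fineK Qfin) -EFinD lee_fin.
rewrite -(fineK Pfin) -(fineK Qfin) -!EFinB /= in rle.
have s0 : (0 <= 1 - b ^+ 2 / 2)%R by lra.
have := sub_sqr_le_affinity P0 P1 Q0 Q1 s0 (le_trans sle rle).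
move: (fine (P A)) (fine (Q A)) => a c acb.
rewrite -lerBlDl; have [//|] := leP (c - a)%R b.
move=> bca; have : (b ^+ 2 < (c - a) ^+ 2)%R.
  by rewrite ltrXn2r// ?nnegrE ?(ltW (le_lt_trans b0 bca)).
by have := sqr_ge0 (b ^+ 2); lra.
Qed.

End two_point.

(** * Power under local alternatives *)

Theorem theorem5p4 (R : realType) (d1 d2 : nat) (delta_star : R)
    (q : R -> euclidean R d1 * euclidean R d2 -> R)
    (score : euclidean R d1 * euclidean R d2 -> R)
    (delta_star_gt0 : 0 < delta_star)
    (q_density : forall delta, `|delta| < delta_star ->
      is_density (lebesgue_blocks R d1 d2) (q delta))
    (score_measurable : measurable_fun setT score)
    (q_factorizes : forall delta, `|delta| < delta_star ->
      factorizes (q delta) <-> delta = 0)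
    (q_qmd : qmd_at0 (lebesgue_blocks R d1 d2) q score)
    (information_gt0 :
      (0 < fisher_information (lebesgue_blocks R d1 d2) (q 0%R) score)%E)
    (score_not_separable : ~ additively_separable score)
    (alpha : R) (alpha_gt0 : 0 < alpha) (alpha_lt1 : alpha < 1)
    (beta : R) (beta_gt0 : 0 < beta) (alpha_beta : alpha + beta < 1) :
  exists2 c : R, 0 < c &
    forall delta0 : R, delta0 != 0 -> `|delta0| <= c ->
      \forall n \near \oo,
        ((1 - alpha - beta)%R%:E <=
          ereal_inf
            [set iid_law (lebesgue_blocks R d1 d2)
                   (q ((Num.sqrt n%:R)^-1 * delta0)%R) n
                   [set s | phi s = false]
            | phi in size_tests
                (iid_law (lebesgue_blocks R d1 d2) (q 0%R) n) alpha])%E.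
Proof.
have nearq : \forall e \near (0 : R),
    is_density (lebesgue_blocks R d1 d2) (q e).
  apply/nbhs_ballP; exists delta_star => //= e.
  by rewrite /ball /= sub0r normrN => /q_density.
have [K K0 HK] := qmd_hellinger_sqr_le nearq score_measurable q_qmd.
have [eps /= eps0 H] := (@nbhs_ballP R R 0 _).1 (filterI nearq HK).
have sK0 : 0 < Num.sqrt K by rewrite sqrtr_gt0.
(* Chosen so that [K * delta0 ^ 2 <= beta ^ 2]; it depends on neither [delta0] nor [n]. *)
exists (beta / Num.sqrt K); first exact: divr_gt0.
move=> delta0 _ delta0_le.
have delta0_sqr : K * delta0 ^+ 2 <= beta ^+ 2.
  rewrite -[delta0 ^+ 2]real_normK ?num_real//.
  rewrite -[X in X * _](sqr_sqrtr (ltW K0)) -exprMn.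
  rewrite ler_pXn2r ?nnegrE ?mulr_ge0 ?(ltW beta_gt0)//.
  by rewrite mulrC -ler_pdivlMr.
(* Beyond this rank [n] exceeds [(|delta0| / eps) ^ 2], which puts [delta0 / sqrt n] in the ball of
   radius [eps]; the successor also forces [0 < n]. *)
exists (Num.truncn ((`|delta0| / eps) ^+ 2)).+1 => //= n /= n_large.
have n_gt0 : (0 < n)%N by exact: leq_trans n_large.
have sn0 : 0 < Num.sqrt (n%:R : R) by rewrite sqrtr_gt0 ltr0n.
set e := (Num.sqrt n%:R)^-1 * delta0.
have e_small : ball (0 : R) eps e.
  rewrite /ball /= sub0r normrN normrM gtr0_norm ?invr_gt0// mulrC.
  rewrite ltr_pdivrMr// mulrC -ltr_pdivrMr//.
  rewrite -(ltr_pXn2r (_ : (0 < 2)%N)) ?nnegrE ?divr_ge0//;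
    rewrite ?(ltW eps0) ?(ltW sn0)//.
  rewrite sqr_sqrtr ?ler0n//; apply: (lt_le_trans (truncnS_gt _)).
  by rewrite ler_nat.
have [dqe Hqe] := H _ e_small.
have dq0 : is_density (lebesgue_blocks R d1 d2) (q 0).
  by apply: q_density; rewrite normr0.
apply: le_ereal_inf_tmp => _ [phi /= size_phi <-].
have mtrue : measurable [set s | phi s = true].
  exact: (measurable_funPTI phi (Y := [set true])).
have phi_false : [set s | phi s = false] = ~` [set s | phi s = true].
  by apply/seteqP; split => s /=; case: (phi s).
have HH : (hellinger_sqr (lebesgue_blocks R d1 d2) (q e) (q 0%R)
    <= (beta ^+ 2 / n%:R)%:E)%E.
  apply: (le_trans Hqe); rewrite lee_fin /e exprMn exprVn sqr_sqrtr ?ler0n//.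
  by rewrite mulrCA mulrC ler_wpM2r// invr_ge0 ler0n.
have beta_le1 : beta <= 1 by lra.
have mfalse : measurable [set s | phi s = false].
  by rewrite phi_false; exact: measurableC.
(* Applied to the acceptance event, whose null probability is at least [1 - alpha]: passing to the
   alternative loses at most [beta]. *)
have := iid_law_le_hellinger dqe dq0 n_gt0 (ltW beta_gt0) beta_le1 HH mfalse.
rewrite phi_false; move: size_phi; rewrite /size_tests /=.
have [P0 ->] := iid_law_probability n dq0.
have [P1 ->] := iid_law_probability n dqe.
rewrite !probability_setC//.
rewrite -(fineK (fin_num_measure P0 _ mtrue)).
rewrite -(fineK (fin_num_measure P1 _ mtrue)).
by rewrite -!EFinB -EFinD !lee_fin; lra.
Qed.
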